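(* Let $d\geq 2$, $\vec\lambda\in(0,\infty)^d$ and $m\in\mathbb{R}^d$ a unit vector, and let $D=\{x\in\mathbb{Z}^d:m\cdot x\geq 0\}$. If $\log\vec\lambda\neq-\|\log\vec\lambda\|\,m$, then $\gamma(H^D)>0$.
   Context: Model (single-species PVBS model). Fix $d\geq 2$ and $\vec\lambda\in(0,\infty)^d$; write $\log\vec\lambda=(\log\lambda_1,\ldots,\log\lambda_d)$. Let $e_1,\ldots,e_d$ be the canonical basis of $\mathbb{Z}^d$. Each site $x$ carries $\mathcal{H}_x=\mathbb{C}^2$ with orthonormal basis $|0\rangle,|1\rangle$; for finite $\Lambda\subset\mathbb{Z}^d$, $\mathcal{H}_\Lambda=\bigotimes_{x\in\Lambda}\mathcal{H}_x$. For $\lambda>0$ let $\phi^{(\lambda)}=(|01\rangle-\lambda|10\rangle)/\sqrt{1+\lambda^2}\in\mathcal{H}_x\otimes\mathcal{H}_{x+e_j}$ (first tensor factor at $x$), and $h_{x,x+e_j}=|\phi^{(\lambda_j)}\rangle\langle\phi^{(\lambda_j)}|+|11\rangle\langle 11|$. For finite $\Lambda$, $H^\Lambda=\sum_{j=1}^d\sum_{x:\,x,x+e_j\in\Lambda}h_{x,x+e_j}$. Half-space Hamiltonian: $H^D$ denotes the Hamiltonian in the GNS representation of the product state in which every site of $D$ is in state $|0\rangle$: its Hilbert space is the closure of the span of product vectors with only finitely many sites of $D$ in state $|1\rangle$, and $H^D$ is the self-adjoint closure of $\sum_{j}\sum_{x,x+e_j\in D}h_{x,x+e_j}$ on this span;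 $H^D\geq 0$ with one-dimensional kernel spanned by the all-$|0\rangle$ vector. Spectral gap: for $H\geq 0$ with $0\in\operatorname{spec}(H)$, $\gamma(H)=\sup\{\delta>0:\operatorname{spec}(H)\cap(0,\delta)=\emptyset\}$, with $\gamma(H)=0$ if no such $\delta$ exists. (Note that the hypothesis excludes $\vec\lambda=(1,\ldots,1)$.) *)

(* Defs.v *)
From Stdlib Require Import Reals Lra List ZArith Classical ClassicalEpsilon.
Import ListNotations.
Open Scope R_scope.

(** * Generic finite sum of a finitely supported real function.
    [fsum f] is the sum of [f] over its (finite) support: the sum over any
    duplicate-free list containing all points where [f] is nonzero (this does
    not depend on the list).  If [f] is not finitely supported, 0. *)
Definition fsum {A : Type} (f : A -> R) : R :=
  match excluded_middle_informative
          (exists L : list A, NoDup L /\ (forall a, f a <> 0 -> In a L)) with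
  | left H =>
      fold_right Rplus 0 (map f (proj1_sig (constructive_indefinite_description _ H)))
  | right _ => 0
  end.

(** * Lattice Z^d.  A site of Z^d is a list of d integers. *)
Definition site := list Z.

Definition shift (x : site) (j : nat) : site :=
  firstn j x ++ (nth j x 0%Z + 1)%Z :: skipn (S j) x.

Definition dotZ (d : nat) (m : nat -> R) (x : site) : R :=
  fold_right Rplus 0 (map (fun i => m i * IZR (nth i x 0%Z)) (seq 0 d)).

Definition inD (d : nat) (m : nat -> R) (x : site) : Prop :=
  length x = d /\ 0 <= dotZ d m x.

(** * Configurations: eta x = true means site x is in state |1>. *)
Definition config := site -> bool.

(** Configurations of the GNS space of the all-|0> product state on D:
    finitely many sites in state |1>, all of them in D. *)
Definition valid_config (d : nat) (m : nat -> R) (eta : config) : Prop :=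
  (exists L : list site, forall x, eta x = true -> In x L) /\
  (forall x, eta x = true -> inD d m x).

Definition swap (eta : config) (x y : site) : config :=
  fun z => if list_eq_dec Z.eq_dec z x then eta y
           else if list_eq_dec Z.eq_dec z y then eta x else eta z.

(** * Local interaction  h_{x,x+e_j} = |phi^(l)><phi^(l)| + |11><11|,
    phi^(l) = (|01> - l |10>)/sqrt(1+l^2) (first factor at x), acting on a
    real coefficient function f (its matrix in the product basis written out). *)
Definition h_local (l : R) (x y : site) (f : config -> R) (eta : config) : R :=
  match eta x, eta y with
  | true, true => f eta
  | false, true => (f eta - l * f (swap eta x y)) / (1 + l ^ 2)
  | true, false => (l ^ 2 * f eta - l * f (swap eta x y)) / (1 + l ^ 2)
  | false, false => 0
  end.

Definition bond_ok (d : nat) (m : nat -> R) (x : site) (j : nat) : Prop :=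
  (j < d)%nat /\ inD d m x /\ inD d m (shift x j).

Definition HDr (d : nat) (lam m : nat -> R) (f : config -> R) (eta : config) : R :=
  fsum (fun b : site * nat =>
          let (x, j) := b in
          if excluded_middle_informative (bond_ok d m x j)
          then h_local (lam j) x (shift x j) f eta else 0).

(** * Complex vectors: coefficient functions config -> C, C = R * R. *)
Definition cvec := config -> R * R.

(** the dense subspace: finite linear combinations of product vectors of the
    GNS space (finitely many sites of D in state |1>) *)
Definition fin_vec (d : nat) (m : nat -> R) (psi : cvec) : Prop :=
  (exists L : list config, forall eta, psi eta <> (0, 0) -> In eta L) /\
  (forall eta, psi eta <> (0, 0) -> valid_config d m eta).

Definition norm2 (psi : cvec) : R :=
  fsum (fun eta => fst (psi eta) ^ 2 + snd (psi eta) ^ 2).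

Definition vsub (psi phi : cvec) : cvec :=
  fun eta => (fst (psi eta) - fst (phi eta), snd (psi eta) - snd (phi eta)).

(** (H^D - mu) psi, for real mu (H^D has real matrix elements, so it acts on
    real and imaginary parts separately) *)
Definition HD_minus (d : nat) (lam m : nat -> R) (mu : R) (psi : cvec) : cvec :=
  fun eta =>
    (HDr d lam m (fun e => fst (psi e)) eta - mu * fst (psi eta),
     HDr d lam m (fun e => snd (psi e)) eta - mu * snd (psi eta)).

(** mu (real) is in the resolvent set of the closure of H^D: H^D - mu is bounded
    below on the core and has dense range (density tested on the dense core).
    For the closure T of an operator A, this is exactly: T - mu is a bijection
    of dom T onto the Hilbert space with bounded inverse. *)
Definition in_resolvent (d : nat) (lam m : nat -> R) (mu : R) : Prop :=
  (exists c, 0 < c /\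
     forall psi, fin_vec d m psi -> c * norm2 psi <= norm2 (HD_minus d lam m mu psi)) /\
  (forall phi, fin_vec d m phi -> forall eps, 0 < eps ->
     exists psi, fin_vec d m psi /\
       norm2 (vsub (HD_minus d lam m mu psi) phi) < eps).

Definition in_spectrum (d : nat) (lam m : nat -> R) (mu : R) : Prop :=
  ~ in_resolvent d lam m mu.

(** gamma(H^D) > 0, i.e. the set {delta > 0 : spec(H^D) /\ (0,delta) = empty}
    is nonempty (gamma is its sup, or 0 if it is empty). *)
Definition spectral_gap_pos (d : nat) (lam m : nat -> R) : Prop :=
  exists delta, 0 < delta /\
    forall mu, 0 < mu < delta -> ~ in_spectrum d lam m mu.

Definition normR (d : nat) (v : nat -> R) : R :=
  sqrt (fold_right Rplus 0 (map (fun i => v i ^ 2) (seq 0 d))).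

(* Main.v *)
(** In every sector with at least one particle the form [<f, H f>] dominates
    [delta |f|^2], with [delta] independent of the particle number.  Since
    [log lambda] is not a nonpositive multiple of [m], some integer vector [U]
    has [m . U >= 0] and [log lambda . U > 0], so from every site of [D] a
    periodic nearest-neighbour path stays in [D] while [lambda^x] grows
    exponentially along it.  Choose one particle of each configuration and move
    it along this path.  A bond term [h_b f] controls the change of
    [f / lambda^x] at each step, or [f] itself when the next site is occupied
    (the term [|11><11|]), so [f] is a geometrically weighted sum of bond terms.
    For a fixed step the move is injective on pairs (configuration, moving
    particle), hence summing over configurations costs one copy of the energy
    per step whichever particle was chosen.

    Coercivity bounds [H - mu] from below for [0 < mu < delta].  As [H]
    preserves the particle number and is bounded in each sector, a Richardson
    iteration inside the core gives the dense range. *)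

Require Import Defs.
From Stdlib Require Import Reals List ZArith.
From Stdlib Require Import Lra Lia Permutation Classical ClassicalEpsilon
  FunctionalExtensionality.
(* [ZArith] also exports a [shift]. *)
Import Defs ListNotations.
Open Scope R_scope.

(** * Sums of finitely supported functions *)

Definition lsum {A : Type} (f : A -> R) (L : list A) : R :=
  fold_right Rplus 0 (map f L).

Lemma lsum_cons {A} (f : A -> R) a L : lsum f (a :: L) = f a + lsum f L.
Proof. reflexivity. Qed.

Lemma lsum_ext {A} (f g : A -> R) L :
  (forall a, In a L -> f a = g a) -> lsum f L = lsum g L.
Proof.
  induction L as [|a L IH]; intros H; [reflexivity|].
  rewrite !lsum_cons, (H a), IH; auto with datatypes.
Qed.

Lemma lsum_0 {A} (f : A -> R) L : (forall a, In a L -> f a = 0) -> lsum f L = 0.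
Proof.
  induction L as [|a L IH]; intros H; [reflexivity|].
  rewrite lsum_cons, (H a), IH; auto with datatypes; ring.
Qed.

Lemma lsum_lin {A} (f g : A -> R) c L :
  lsum (fun a => c * f a + g a) L = c * lsum f L + lsum g L.
Proof.
  induction L as [|a L IH]; [unfold lsum; simpl; ring|].
  rewrite !lsum_cons, IH; ring.
Qed.

Lemma lsum_le {A} (f g : A -> R) L :
  (forall a, In a L -> f a <= g a) -> lsum f L <= lsum g L.
Proof.
  induction L as [|a L IH]; intros H; [apply Rle_refl|].
  rewrite !lsum_cons; apply Rplus_le_compat; auto with datatypes.
Qed.

Lemma lsum_const {A} (c : R) (L : list A) :
  lsum (fun _ => c) L = INR (length L) * c.
Proof.
  induction L as [|a L IH]; [unfold lsum; simpl; ring|].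
  rewrite lsum_cons, IH; simpl length; rewrite S_INR; ring.
Qed.

Lemma lsum_app {A} (f : A -> R) L M : lsum f (L ++ M) = lsum f L + lsum f M.
Proof.
  induction L as [|a L IH]; [unfold lsum; simpl; ring|].
  simpl app; rewrite !lsum_cons, IH; ring.
Qed.

Lemma lsum_map {A B} (f : B -> R) (g : A -> B) L :
  lsum f (map g L) = lsum (fun a => f (g a)) L.
Proof. unfold lsum; rewrite map_map; reflexivity. Qed.

Lemma lsum_perm {A} (f : A -> R) L M : Permutation L M -> lsum f L = lsum f M.
Proof.
  induction 1; rewrite ?lsum_cons in *; try ring; try congruence.
Qed.

Lemma lsum_swap {A B} (F : A -> B -> R) L M :
  lsum (fun a => lsum (F a) M) L = lsum (fun b => lsum (fun a => F a b) L) M.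
Proof.
  induction L as [|a L IH].
  - symmetry; apply lsum_0; reflexivity.
  - rewrite lsum_cons, IH.
    transitivity (lsum (fun b => 1 * F a b + lsum (fun a => F a b) L) M).
    + rewrite lsum_lin, Rmult_1_l; reflexivity.
    + apply lsum_ext; intros b _; rewrite lsum_cons; ring.
Qed.

Lemma lsum_list_prod {A B} (F : A -> B -> R) L M :
  lsum (fun p => F (fst p) (snd p)) (list_prod L M) =
  lsum (fun a => lsum (F a) M) L.
Proof.
  induction L as [|a L IH]; [reflexivity|].
  simpl list_prod; rewrite lsum_app, lsum_map, lsum_cons, IH; reflexivity.
Qed.

(** [M] may contain repetitions: each point of [L] that matters is moved to the front of [M] and
    cancelled, and what is left over is nonnegative. *)
Lemma lsum_le_support {A} (f : A -> R) L M :
  (forall a, 0 <= f a) -> NoDup L ->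
  (forall a, In a L -> f a <> 0 -> In a M) -> lsum f L <= lsum f M.
Proof.
  intros Hf HL; revert M.
  induction HL as [|a L Ha HL IH]; intros M HM.
  - transitivity (lsum (fun _ : A => 0) M); [rewrite lsum_const; right; unfold lsum; simpl; ring|].
    apply lsum_le; auto.
  - rewrite lsum_cons.
    destruct (Req_EM_T (f a) 0) as [E|E].
    + rewrite E, Rplus_0_l; apply IH; auto with datatypes.
    + destruct (in_split a M (HM a (or_introl eq_refl) E)) as (l1 & l2 & ->).
      rewrite (lsum_perm f (l1 ++ a :: l2) (a :: l1 ++ l2))
        by (symmetry; apply Permutation_middle).
      rewrite lsum_cons; apply Rplus_le_compat_l, IH; intros b Hb Hn.
      assert (In b (l1 ++ a :: l2)) as H by auto with datatypes.
      apply in_app_or in H; apply in_or_app.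
      destruct H as [|[<-|]]; tauto.
Qed.

(** Dropping the zero terms turns both lists into permutations of each other. This makes [fsum]
    independent of the list it picks. *)
Lemma lsum_support {A} (f : A -> R) L M :
  NoDup L -> NoDup M -> (forall a, f a <> 0 -> (In a L <-> In a M)) ->
  lsum f L = lsum f M.
Proof.
  intros HL HM H.
  set (nz := fun a => if Req_EM_T (f a) 0 then false else true).
  assert (E : forall K, lsum f K = lsum f (filter nz K)).
  { induction K as [|a K IH]; [reflexivity|].
    simpl; unfold nz at 1; destruct (Req_EM_T (f a) 0) as [E|E];
      rewrite !lsum_cons, IH; [rewrite E; ring|reflexivity]. }
  rewrite (E L), (E M).
  apply lsum_perm, NoDup_Permutation; try (apply NoDup_filter; assumption).
  intros a; rewrite !filter_In; unfold nz.
  destruct (Req_EM_T (f a) 0) as [Ea|Ea]; [split; intros [_ ?]; discriminate|].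
  specialize (H a Ea); tauto.
Qed.

Definition finsupp {A : Type} (f : A -> R) : Prop :=
  exists L, forall a, f a <> 0 -> In a L.

(** Configurations are functions, so equality has to be decided classically. *)
Lemma dedup {A} (L : list A) : exists M, NoDup M /\ forall a, In a M <-> In a L.
Proof.
  set (dec := fun a b : A => excluded_middle_informative (a = b)).
  exists (nodup dec L); split; [apply NoDup_nodup|intros; apply nodup_In].
Qed.

Lemma finsupp_nodup {A} (f : A -> R) :
  finsupp f -> exists L, NoDup L /\ forall a, f a <> 0 -> In a L.
Proof.
  intros [L HL]; destruct (dedup L) as (M & HM & E).
  exists M; split; auto; intros a Ha; apply E, HL, Ha.
Qed.

Lemma finsupp_incl {A} (f g : A -> R) :
  finsupp f -> (forall a, g a <> 0 -> f a <> 0) -> finsupp g.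
Proof. intros [L HL] H; exists L; auto. Qed.

Lemma finsupp_lin {A} (f g : A -> R) c :
  finsupp f -> finsupp g -> finsupp (fun a => c * f a + g a).
Proof.
  intros [L HL] [M HM]; exists (L ++ M); intros a Ha; apply in_or_app.
  destruct (Req_EM_T (f a) 0) as [E|E]; [right|left; auto].
  apply HM; intros E'; apply Ha; rewrite E, E'; ring.
Qed.

Lemma fsum_lsum {A} (f : A -> R) L :
  NoDup L -> (forall a, f a <> 0 -> In a L) -> fsum f = lsum f L.
Proof.
  intros HL H; unfold fsum.
  destruct (excluded_middle_informative _) as [e|n].
  - destruct (constructive_indefinite_description _ e) as [M [HM HM']]; simpl.
    apply lsum_support; auto; intros a Ha; split; auto.
  - contradict n; exists L; auto.
Qed.

Lemma fsum_lin {A} (f g : A -> R) c :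
  finsupp f -> finsupp g ->
  fsum (fun a => c * f a + g a) = c * fsum f + fsum g.
Proof.
  intros [L HL] [M HM]; destruct (dedup (L ++ M)) as (K & HK & E).
  assert (H : forall h : A -> R, (forall a, h a <> 0 -> f a <> 0 \/ g a <> 0) ->
     fsum h = lsum h K).
  { intros h Hh; apply fsum_lsum; auto; intros a Ha; apply E, in_or_app.
    destruct (Hh a Ha); auto. }
  rewrite !H; auto using lsum_lin.
  intros a Ha; apply NNPP; intros N; apply Ha.
  replace (f a) with 0 by (apply NNPP; intro; apply N; left; congruence).
  replace (g a) with 0 by (apply NNPP; intro; apply N; right; congruence).
  ring.
Qed.

Lemma fsum_le {A} (f g : A -> R) :
  finsupp f -> finsupp g -> (forall a, f a <= g a) -> fsum f <= fsum g.
Proof.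
  intros [L HL] [M HM] Hle; destruct (dedup (L ++ M)) as (K & HK & E).
  rewrite (fsum_lsum f K), (fsum_lsum g K); auto.
  - apply lsum_le; auto.
  - intros a Ha; apply E, in_or_app; auto.
  - intros a Ha; apply E, in_or_app; auto.
Qed.

Lemma fsum_0 {A} : fsum (fun _ : A => 0) = 0.
Proof. rewrite (fsum_lsum _ []); [reflexivity|constructor|intros; lra]. Qed.

Lemma finsupp_0 {A} : finsupp (fun _ : A => 0).
Proof. exists []; intros; lra. Qed.

Lemma fsum_lin3 {A} (f g h : A -> R) a b c :
  finsupp f -> finsupp g -> finsupp h ->
  fsum (fun x => a * f x + (b * g x + (c * h x + 0))) =
  a * fsum f + (b * fsum g + c * fsum h).
Proof.
  intros; rewrite !fsum_lin, fsum_0; auto using finsupp_lin, finsupp_0; ring.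
Qed.

Lemma fsum_neq0 {A} (f : A -> R) : fsum f <> 0 -> exists a, f a <> 0.
Proof.
  intros H; apply NNPP; intros N; apply H.
  replace f with (fun _ : A => 0); [apply fsum_0|].
  extensionality a; apply NNPP; intros E; apply N; exists a; congruence.
Qed.

Lemma fsum_nonneg {A} (f : A -> R) : (forall a, 0 <= f a) -> finsupp f -> 0 <= fsum f.
Proof.
  intros Hf H; rewrite <- (@fsum_0 A); apply fsum_le; auto using finsupp_0.
Qed.

Lemma lsum_le_fsum {A} (f : A -> R) L :
  (forall a, 0 <= f a) -> finsupp f -> NoDup L -> lsum f L <= fsum f.
Proof.
  intros Hf H HL; destruct (finsupp_nodup f H) as (M & HM & HM').
  rewrite (fsum_lsum f M); auto; apply lsum_le_support; auto.
Qed.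

Lemma fsum_ge_term {A} (f : A -> R) a :
  (forall a, 0 <= f a) -> finsupp f -> f a <= fsum f.
Proof.
  intros Hf H; transitivity (lsum f [a]); [unfold lsum; simpl; lra|].
  apply lsum_le_fsum; auto; constructor; [intros []|constructor].
Qed.

Lemma fsum_involution {A} (f : A -> R) (s : A -> A) :
  (forall a, s (s a) = a) -> finsupp f -> fsum (fun a => f (s a)) = fsum f.
Proof.
  intros Hs H; destruct (finsupp_nodup f H) as (M & HM & HM').
  rewrite (fsum_lsum f M), (fsum_lsum _ (map s M)); auto.
  - rewrite lsum_map; apply lsum_ext; intros; rewrite Hs; auto.
  - apply NoDup_map_NoDup_ForallPairs; auto.
    intros a b _ _ E; rewrite <- (Hs a), <- (Hs b), E; auto.
  - intros a Ha; rewrite <- (Hs a); apply in_map; auto.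
Qed.

Lemma finsupp_fst {A B} (F : A -> B -> R) :
  finsupp (fun p => F (fst p) (snd p)) -> finsupp (fun a => fsum (F a)).
Proof.
  intros [L HL]; exists (map fst L); intros a Ha.
  apply fsum_neq0 in Ha as [b Hb]; apply (in_map fst _ (a, b)), HL; auto.
Qed.

Lemma finsupp_row {A B} (F : A -> B -> R) a :
  finsupp (fun p => F (fst p) (snd p)) -> finsupp (F a).
Proof.
  intros [L HL]; exists (map snd L); intros b Hb.
  apply (in_map snd _ (a, b)), HL; auto.
Qed.

Lemma finsupp_col {A B} (F : A -> B -> R) b :
  finsupp (fun p => F (fst p) (snd p)) -> finsupp (fun a => F a b).
Proof.
  intros [L HL]; exists (map fst L); intros a Hb.
  apply (in_map fst _ (a, b)), HL; auto.
Qed.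

Lemma finsupp_mul {A} (f g : A -> R) : finsupp g -> finsupp (fun a => f a * g a).
Proof. intros H; apply (finsupp_incl g); auto; intros a Ha E; apply Ha; rewrite E; ring. Qed.

Lemma finsupp_sqr {A} (f : A -> R) : finsupp f -> finsupp (fun a => f a ^ 2).
Proof. intros H; apply (finsupp_incl f); auto; intros a Ha E; apply Ha; rewrite E; ring. Qed.

(** Fubini: all three sums reduce to one finite rectangle, the product of the two projections of the
    support. *)
Lemma fsum_pair {A B} (F : A -> B -> R) :
  finsupp (fun p => F (fst p) (snd p)) ->
  fsum (fun a => fsum (F a)) = fsum (fun p => F (fst p) (snd p)) /\
  fsum (fun b => fsum (fun a => F a b)) = fsum (fun p => F (fst p) (snd p)).
Proof.
  intros H; destruct (finsupp_nodup _ H) as (M & HM & HM').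
  destruct (dedup (map fst M)) as (K & HK & EK).
  destruct (dedup (map snd M)) as (L & HL & EL).
  assert (IK : forall a b, F a b <> 0 -> In a K).
  { intros a b Hab; apply EK, (in_map fst _ (a, b)), HM'; auto. }
  assert (IL : forall a b, F a b <> 0 -> In b L).
  { intros a b Hab; apply EL, (in_map snd _ (a, b)), HM'; auto. }
  assert (E : fsum (fun p => F (fst p) (snd p)) =
              lsum (fun a => lsum (F a) L) K).
  { rewrite <- lsum_list_prod, (fsum_lsum _ M); auto.
    assert (ND : NoDup (list_prod K L)).
    { clear - HK HL; induction HK as [|a K Ha HK IH]; [constructor|].
      simpl; apply NoDup_app; auto.
      - apply NoDup_map_NoDup_ForallPairs; auto.
        intros ? ? _ _ [=]; auto.
      - intros [x y] H1 H2; apply in_map_iff in H1 as (b & [= -> ->] & _).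
        apply in_prod_iff in H2; tauto. }
    apply lsum_support; auto; intros [a b] Hab; simpl in Hab.
    split; intros _; [apply in_prod; eauto|apply HM'; auto]. }
  rewrite E; split.
  - rewrite (fsum_lsum _ K); auto.
    + apply lsum_ext; intros a _; apply fsum_lsum; eauto.
    + intros a Ha; apply fsum_neq0 in Ha as [b Hb]; eauto.
  - rewrite lsum_swap, (fsum_lsum _ L); auto.
    + apply lsum_ext; intros b _; apply fsum_lsum; eauto.
    + intros b Hb; apply fsum_neq0 in Hb as [a Ha]; eauto.
Qed.

Lemma cauchy_schwarz_1 {A} (f : A -> R) L :
  lsum f L ^ 2 <= INR (length L) * lsum (fun a => f a ^ 2) L.
Proof.
  induction L as [|a L IH]; [unfold lsum; simpl; lra|].
  rewrite !lsum_cons; simpl length; rewrite S_INR.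
  assert (Hc : 2 * f a * lsum f L <= INR (length L) * f a ^ 2 + lsum (fun a => f a ^ 2) L).
  { clear IH; induction L as [|b L IH]; [unfold lsum; simpl; lra|].
    rewrite !lsum_cons; simpl length; rewrite S_INR.
    pose proof (pow2_ge_0 (f a - f b)); lra. }
  lra.
Qed.

(** * Sites and moves *)

Definition down (x : site) (j : nat) : site :=
  firstn j x ++ (nth j x 0%Z - 1)%Z :: skipn (S j) x.

Lemma shift_cons a (x : site) j : shift (a :: x) (S j) = a :: shift x j.
Proof. reflexivity. Qed.

Lemma down_cons a (x : site) j : down (a :: x) (S j) = a :: down x j.
Proof. reflexivity. Qed.

Lemma shift_down x j : (j < length x)%nat -> shift (down x j) j = x.
Proof.
  revert j; induction x as [|a x IH]; intros [|j] H; simpl in H; try lia.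
  - unfold shift, down; simpl; f_equal; lia.
  - rewrite down_cons, shift_cons, IH; auto; lia.
Qed.

Lemma down_shift x j : (j < length x)%nat -> down (shift x j) j = x.
Proof.
  revert j; induction x as [|a x IH]; intros [|j] H; simpl in H; try lia.
  - unfold shift, down; simpl; f_equal; lia.
  - rewrite shift_cons, down_cons, IH; auto; lia.
Qed.

Lemma length_shift x j : (j < length x)%nat -> length (shift x j) = length x.
Proof.
  revert j; induction x as [|a x IH]; intros [|j] H; simpl in H; try lia.
  - reflexivity.
  - rewrite shift_cons; simpl; rewrite IH; lia.
Qed.

Lemma length_down x j : (j < length x)%nat -> length (down x j) = length x.
Proof.
  revert j; induction x as [|a x IH]; intros [|j] H; simpl in H; try lia.
  - reflexivity.
  - rewrite down_cons; simpl; rewrite IH; lia.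
Qed.

Lemma nth_shift x j i : (j < length x)%nat ->
  nth i (shift x j) 0%Z = (nth i x 0 + if Nat.eqb i j then 1 else 0)%Z.
Proof.
  revert i j; induction x as [|a x IH]; intros i [|j] H; simpl in H; try lia.
  - destruct i; unfold shift; simpl; lia.
  - rewrite shift_cons; destruct i; simpl; [lia|apply IH; lia].
Qed.

Lemma dotZ_shift d m x j : (j < d)%nat -> length x = d ->
  dotZ d m (shift x j) = dotZ d m x + m j.
Proof.
  intros Hj Hx.
  change (lsum (fun i => m i * IZR (nth i (shift x j) 0%Z)) (seq 0 d) =
          lsum (fun i => m i * IZR (nth i x 0%Z)) (seq 0 d) + m j).
  transitivity (lsum (fun i => 1 * (if Nat.eqb i j then m j else 0) +
                               m i * IZR (nth i x 0%Z)) (seq 0 d)).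
  - apply lsum_ext; intros i _; rewrite nth_shift, plus_IZR by lia.
    destruct (Nat.eqb_spec i j) as [->|]; ring.
  - rewrite lsum_lin, (lsum_support _ (seq 0 d) [j]).
    + unfold lsum at 1; simpl; rewrite Nat.eqb_refl; ring.
    + apply seq_NoDup.
    + constructor; [intros []|constructor].
    + intros i; destruct (Nat.eqb_spec i j) as [->|]; [|lra].
      intros _; rewrite in_seq; simpl; split; auto; lia.
Qed.

Lemma swap_l eta x y : swap eta x y x = eta y.
Proof. unfold swap; destruct (list_eq_dec Z.eq_dec x x); congruence. Qed.

Lemma swap_r eta x y : swap eta x y y = eta x.
Proof.
  unfold swap; destruct (list_eq_dec Z.eq_dec y x); [congruence|].
  destruct (list_eq_dec Z.eq_dec y y); congruence.
Qed.

Lemma swap_other eta x y z : z <> x -> z <> y -> swap eta x y z = eta z.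
Proof.
  intros; unfold swap; destruct (list_eq_dec Z.eq_dec z x); [contradiction|].
  destruct (list_eq_dec Z.eq_dec z y); [contradiction|reflexivity].
Qed.

Lemma swap_comm eta x y : swap eta x y = swap eta y x.
Proof.
  extensionality z.
  destruct (list_eq_dec Z.eq_dec z x) as [->|Hx]; [rewrite swap_l, swap_r; auto|].
  destruct (list_eq_dec Z.eq_dec z y) as [->|Hy]; [rewrite swap_l, swap_r; auto|].
  rewrite !swap_other; auto.
Qed.

Lemma swap_invol eta x y : swap (swap eta x y) x y = eta.
Proof.
  extensionality z.
  destruct (list_eq_dec Z.eq_dec z x) as [->|Hx]; [rewrite swap_l, swap_r; auto|].
  destruct (list_eq_dec Z.eq_dec z y) as [->|Hy]; [rewrite swap_r, swap_l; auto|].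
  rewrite !swap_other; auto.
Qed.

(** * The bond projections *)

Lemma one_plus_sqr_neq0 l : 1 + l ^ 2 <> 0.
Proof. nra. Qed.

(* With [h] the projection, [h (f - h)] is antisymmetric under the swap, so
   it sums to 0: this is [<f, h f> = |h f|^2]. *)
Lemma h_local_antisym l x y f eta :
  let h := h_local l x y f in
  h eta * (f eta - h eta) +
  h (swap eta x y) * (f (swap eta x y) - h (swap eta x y)) = 0.
Proof.
  assert (H := one_plus_sqr_neq0 l).
  simpl; unfold h_local; rewrite swap_l, swap_r, swap_invol.
  destruct (eta x), (eta y); field; auto.
Qed.

Section Model.

Context (d : nat) (lam m : nat -> R).

(** The summand of [HDr] with the bond as last argument, kept in the same form so that [HDr_fsum]
    holds by conversion. *)
Definition hb (f : config -> R) (eta : config) (b : site * nat) : R :=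
  let (x, j) := b in
  if excluded_middle_informative (bond_ok d m x j)
  then h_local (lam j) x (shift x j) f eta else 0.

Definition fin (f : config -> R) : Prop :=
  finsupp f /\ forall eta, f eta <> 0 -> valid_config d m eta.

(** This is the quadratic form of $H^D$ written as the sum of $\|h_b f\|^2$ over bonds;
    [quadratic_form_energy] identifies the two. *)
Definition energy (f : config -> R) : R :=
  fsum (fun p : config * (site * nat) => hb f (fst p) (snd p) ^ 2).

Lemma fin_lin f g c : fin f -> fin g -> fin (fun eta => c * f eta + g eta).
Proof.
  intros [Hf Vf] [Hg Vg]; split; [apply finsupp_lin; auto|].
  intros eta H; destruct (Req_EM_T (f eta) 0) as [E|E]; auto.
  apply Vg; intros E'; apply H; rewrite E, E'; ring.
Qed.

Lemma hb_lin f g c eta b :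
  hb (fun e => c * f e + g e) eta b = c * hb f eta b + hb g eta b.
Proof.
  destruct b as [x j]; unfold hb.
  destruct (excluded_middle_informative _); [|ring].
  assert (H := one_plus_sqr_neq0 (lam j)).
  unfold h_local; destruct (eta x), (eta (shift x j)); field; auto.
Qed.

Lemma hb_neq0 f eta x j : hb f eta (x, j) <> 0 ->
  bond_ok d m x j /\ (eta x = true \/ eta (shift x j) = true) /\
  (f eta <> 0 \/ f (swap eta x (shift x j)) <> 0).
Proof.
  unfold hb; destruct (excluded_middle_informative _) as [ok|]; [|lra].
  intros H; split; [auto|split].
  - unfold h_local in H; destruct (eta x), (eta (shift x j)); auto; lra.
  - destruct (Req_EM_T (f eta) 0) as [E|]; [right|auto]; intros E'; apply H.
    unfold h_local; rewrite E, E'; destruct (eta x), (eta (shift x j)); unfold Rdiv; ring.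
Qed.

(** The first half covers bonds whose lower end lies in [X], the second those whose upper end does.
    Repetitions are harmless, as only an upper bound on the number of bonds is needed. *)
Definition touching (X : list site) : list (site * nat) :=
  list_prod X (seq 0 d) ++
  map (fun p => (down (fst p) (snd p), snd p)) (list_prod X (seq 0 d)).

Lemma in_touching X x j :
  bond_ok d m x j -> In x X \/ In (shift x j) X -> In (x, j) (touching X).
Proof.
  intros (Hj & [Hx _] & _) H; apply in_or_app.
  destruct H; [left|right; apply in_map_iff; exists (shift x j, j); simpl;
    rewrite down_shift by lia; split; auto];
    apply in_prod; auto; apply in_seq; lia.
Qed.

Lemma length_touching X : length (touching X) = (2 * d * length X)%nat.
Proof.
  unfold touching; rewrite length_app, length_map, length_prod, length_seq; lia.
Qed.

Lemma swap_occupied eta x y z : swap eta x y z = true ->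
  z = x /\ eta y = true \/ z = y /\ eta x = true \/ eta z = true.
Proof.
  intros H; destruct (list_eq_dec Z.eq_dec z x) as [->|Hx];
    [rewrite swap_l in H; auto|].
  destruct (list_eq_dec Z.eq_dec z y) as [->|Hy]; [rewrite swap_r in H; auto|].
  rewrite swap_other in H; auto.
Qed.

Lemma valid_swap eta x y : inD d m x -> inD d m y ->
  valid_config d m eta -> valid_config d m (swap eta x y).
Proof.
  intros Hx Hy [[X HX] HD]; split.
  - exists (x :: y :: X); intros z Hz.
    apply swap_occupied in Hz as [[-> _]|[[-> _]|H]]; simpl; auto.
  - intros z Hz; apply swap_occupied in Hz as [[-> _]|[[-> _]|H]]; auto.
Qed.

Lemma hb_valid f eta b : fin f -> hb f eta b <> 0 -> valid_config d m eta.
Proof.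
  intros [_ V] H; destruct b as [x j].
  apply hb_neq0 in H as ((_ & Hx & Hy) & _ & [H|H]); apply V in H; auto.
  rewrite <- (swap_invol eta x (shift x j)); apply valid_swap; auto.
Qed.

Lemma hb_finsupp f : fin f ->
  finsupp (fun p : config * (site * nat) => hb f (fst p) (snd p)).
Proof.
  intros [[L HL] V].
  assert (HX : exists X, forall eta x, f eta <> 0 -> eta x = true -> In x X).
  { assert (HX : exists X, forall eta x, In eta L -> f eta <> 0 -> eta x = true -> In x X).
    { clear HL; induction L as [|e L [X IH]]; [exists []; intros ? ? []|].
      destruct (Req_EM_T (f e) 0) as [E|E].
      - exists X; intros eta x [<-|Hin] Hf; [contradiction|eauto].
      - destruct (V e E) as [[Y HY] _]; exists (Y ++ X).
        intros eta x [<-|Hin] Hf He; apply in_or_app; eauto. }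
    destruct HX as [X HX]; exists X; eauto. }
  destruct HX as [X HX].
  set (B := touching X).
  (* A bond term is nonzero at [eta] only if [f] is nonzero at [eta] or at its swap, and only on
     bonds touching a particle. *)
  exists (list_prod (L ++ map (fun p => swap (fst p) (fst (snd p))
             (shift (fst (snd p)) (snd (snd p)))) (list_prod L B)) B).
  intros [eta [x j]] H; simpl in H.
  apply hb_neq0 in H as (ok & Ho & Hf).
  set (y := shift x j) in *.
  assert (In (x, j) B).
  { apply in_touching; auto; fold y; destruct Hf as [Hf|Hf].
    - destruct Ho; [left|right]; eauto.
    - destruct Ho; [right|left]; eapply HX; eauto; [rewrite swap_r|rewrite swap_l]; auto. }
  apply in_prod; auto; apply in_or_app.
  destruct Hf as [Hf|Hf]; [left; auto|right].
  apply in_map_iff; exists (swap eta x y, (x, j)); split.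
  - simpl; fold y; apply swap_invol.
  - apply in_prod; auto.
Qed.

Lemma HDr_fsum f eta : HDr d lam m f eta = fsum (hb f eta).
Proof. reflexivity. Qed.

Lemma fin_HDr f : fin f -> fin (HDr d lam m f).
Proof.
  intros Hf; split.
  - apply (finsupp_fst (hb f)), hb_finsupp, Hf.
  - intros eta H; rewrite HDr_fsum in H; apply fsum_neq0 in H as [b Hb].
    eapply hb_valid; eauto.
Qed.

Lemma HDr_lin f g c eta : fin f -> fin g ->
  HDr d lam m (fun e => c * f e + g e) eta =
  c * HDr d lam m f eta + HDr d lam m g eta.
Proof.
  intros Hf Hg; rewrite !HDr_fsum.
  rewrite <- fsum_lin by (apply finsupp_row, hb_finsupp; auto).
  f_equal; extensionality b; apply hb_lin.
Qed.

(** The swap is an involution on configurations, so the defect [D] has the same sum as its swapped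
    copy. By [h_local_antisym] the two sums add up to 0, hence each vanishes. *)
Lemma hb_quadratic f b : fin f ->
  fsum (fun eta => f eta * hb f eta b) = fsum (fun eta => hb f eta b ^ 2).
Proof.
  intros Hf; assert (S := finsupp_col _ b (hb_finsupp f Hf)); simpl in S.
  set (D := fun eta => hb f eta b * (f eta - hb f eta b)).
  assert (SD : finsupp D).
  { apply (finsupp_incl _ _ S); unfold D; intros eta H E; apply H; rewrite E; ring. }
  assert (HD : fsum D = 0).
  { destruct b as [x j].
    set (s := fun eta => swap eta x (shift x j)).
    assert (Hs : fsum (fun eta => D (s eta)) = fsum D).
    { apply fsum_involution; auto; intros; apply swap_invol. }
    assert (S' : finsupp (fun eta => D (s eta))).
    { destruct SD as [L HL]; exists (map s L); intros eta He.
      replace eta with (s (s eta)) by apply swap_invol; apply in_map; auto. }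
    assert (E : fsum (fun eta => 1 * D (s eta) + D eta) = 0).
    { rewrite <- (@fsum_0 config); f_equal; extensionality eta.
      unfold D, hb; destruct (excluded_middle_informative _); [|ring].
      rewrite <- (h_local_antisym (lam j) x (shift x j) f eta); unfold s; ring. }
    rewrite fsum_lin, Hs in E; auto; lra. }
  transitivity (fsum (fun eta => 1 * D eta + hb f eta b ^ 2)).
  - f_equal; extensionality eta; unfold D; ring.
  - rewrite fsum_lin, HD; auto using finsupp_sqr; ring.
Qed.

Lemma quadratic_form_energy f : fin f ->
  fsum (fun eta => f eta * HDr d lam m f eta) = energy f.
Proof.
  intros Hf; assert (S := hb_finsupp f Hf).
  assert (S2 : finsupp (fun p => f (fst p) * hb f (fst p) (snd p)))
    by (apply (finsupp_mul (fun p => f (fst p))); auto).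
  transitivity (fsum (fun eta => fsum (fun b => f eta * hb f eta b))).
  - f_equal; extensionality eta; rewrite HDr_fsum.
    transitivity (fsum (fun b => f eta * hb f eta b + 0)).
    + rewrite fsum_lin, fsum_0; auto using finsupp_0; [ring|].
      apply (finsupp_row _ eta S).
    + f_equal; extensionality b; ring.
  - destruct (fsum_pair (fun eta b => f eta * hb f eta b) S2) as [E1 E2].
    rewrite E1, <- E2.
    destruct (fsum_pair (fun eta b => hb f eta b ^ 2) (finsupp_sqr _ S)) as [_ E3].
    unfold energy; rewrite <- E3.
    f_equal; extensionality b; apply hb_quadratic; auto.
Qed.

(** * Particle-number sectors and boundedness of the Hamiltonian on them *)

Definition count_le (N : nat) (eta : config) : Prop :=
  exists X, (length X <= N)%nat /\ forall x, eta x = true -> In x X.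

Lemma count_le_swap N eta x y : count_le N eta -> count_le N (swap eta x y).
Proof.
  intros (X & HN & HX).
  set (t := fun z => if list_eq_dec Z.eq_dec z x then y
                     else if list_eq_dec Z.eq_dec z y then x else z).
  exists (map t X); split; [rewrite length_map; auto|].
  intros z Hz; apply in_map_iff.
  destruct (list_eq_dec Z.eq_dec z x) as [->|Hx].
  { rewrite swap_l in Hz; exists y; split; auto.
    unfold t; destruct (list_eq_dec Z.eq_dec y x), (list_eq_dec Z.eq_dec y y); congruence. }
  destruct (list_eq_dec Z.eq_dec z y) as [->|Hy].
  { rewrite swap_r in Hz; exists x; split; auto.
    unfold t; destruct (list_eq_dec Z.eq_dec x x); congruence. }
  rewrite swap_other in Hz; auto; exists z; split; auto.
  unfold t; destruct (list_eq_dec Z.eq_dec z x), (list_eq_dec Z.eq_dec z y); congruence.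
Qed.

(** At most [N] particles rather than exactly [N], so that every finitely supported vector lies in
    some sector ([fin_sector]). *)
Definition sector (N : nat) (f : config -> R) : Prop :=
  forall eta, f eta <> 0 -> count_le N eta.

Lemma hb_sector N f eta b : sector N f -> hb f eta b <> 0 -> count_le N eta.
Proof.
  intros H Hb; destruct b as [x j].
  apply hb_neq0 in Hb as (_ & _ & [Hb|Hb]); apply H in Hb; auto.
  rewrite <- (swap_invol eta x (shift x j)); apply count_le_swap; auto.
Qed.

Lemma HDr_sector N f : sector N f -> sector N (HDr d lam m f).
Proof.
  intros H eta He; rewrite HDr_fsum in He.
  apply fsum_neq0 in He as [b Hb]; eapply hb_sector; eauto.
Qed.

(** A configuration with at most [N] particles meets at most [2 * d * N] bonds; Cauchy-Schwarz over
    these bonds gives the factor. *)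
Lemma HDr_norm_le_energy N f : fin f -> sector N f ->
  fsum (fun eta => HDr d lam m f eta ^ 2) <= INR (2 * d * N) * energy f.
Proof.
  intros Hf HN; assert (S := finsupp_sqr _ (hb_finsupp f Hf)).
  destruct (fsum_pair (fun eta b => hb f eta b ^ 2) S) as [E _].
  unfold energy; rewrite <- E.
  assert (S1 := finsupp_fst (fun eta b => hb f eta b ^ 2) S); simpl in S1.
  transitivity (fsum (fun eta =>
    INR (2 * d * N) * fsum (fun b => hb f eta b ^ 2) + 0)).
  - apply fsum_le.
    + apply finsupp_sqr, fin_HDr, Hf.
    + apply finsupp_lin; auto using finsupp_0.
    + intros eta; rewrite Rplus_0_r, HDr_fsum.
      destruct (classic (count_le N eta)) as [(X & HX & HX')|Hn].
      * destruct (dedup (touching X)) as (T & HT & ET).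
        assert (HT' : forall b, hb f eta b <> 0 -> In b T).
        { intros [x j] Hb; apply ET; apply hb_neq0 in Hb as (ok & Ho & _).
          apply in_touching; auto; destruct Ho; auto. }
        rewrite (fsum_lsum _ T), (fsum_lsum _ T); auto.
        2:{ intros b Hb; apply HT'; intros E'; apply Hb; rewrite E'; ring. }
        eapply Rle_trans; [apply cauchy_schwarz_1|].
        apply Rmult_le_compat_r.
        { rewrite <- (Rmult_0_r (INR (length T))), <- lsum_const.
          apply lsum_le; intros; apply pow2_ge_0. }
        apply le_INR; transitivity (length (touching X)).
        { apply NoDup_incl_length; auto; intros b Hb; apply ET; auto. }
        rewrite length_touching; nia.
      * assert (E0 : forall b, hb f eta b = 0).
        { intros b; apply NNPP; intros Hb; apply Hn; eapply hb_sector; eauto. }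
        replace (hb f eta) with (fun _ : site * nat => 0)
          by (extensionality b; auto).
        rewrite fsum_0; replace (fun _ : site * nat => 0 ^ 2) with (fun _ : site * nat => 0)
          by (extensionality b; ring).
        rewrite fsum_0; lra.
  - rewrite fsum_lin, fsum_0; auto using finsupp_0; lra.
Qed.

End Model.

(** * Coercivity: moving one particle along a path *)

(** A coordinate direction with an orientation: [true] steps along $e_j$, [false] against it. *)
Definition step := (nat * bool)%type.

Definition move (s : step) (y : site) : site :=
  if snd s then shift y (fst s) else down y (fst s).

(** The bond between [y] and [move s y], named by its lower end as in the Hamiltonian. *)
Definition bond (s : step) (y : site) : site * nat :=
  (if snd s then y else down y (fst s), fst s).

Definition sgn (s : step) (v : nat -> R) : R :=
  if snd s then v (fst s) else - v (fst s).

Definition unmove (s : step) (y : site) : site := move (fst s, negb (snd s)) y.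

Lemma unmove_move s y : (fst s < length y)%nat -> unmove s (move s y) = y.
Proof.
  destruct s as [j []]; unfold unmove, move; simpl; intros H;
    [apply down_shift|apply shift_down]; auto.
Qed.

Lemma length_move s y : (fst s < length y)%nat -> length (move s y) = length y.
Proof.
  destruct s as [j []]; unfold move; simpl; intros H;
    [apply length_shift|apply length_down]; auto.
Qed.

Lemma dotZ_move d m s y : (fst s < d)%nat -> length y = d ->
  dotZ d m (move s y) = dotZ d m y + sgn s m.
Proof.
  destruct s as [j []]; unfold move, sgn; simpl; intros Hj Hy.
  - apply dotZ_shift; auto.
  - rewrite <- (shift_down y j) at 2 by lia.
    rewrite dotZ_shift; auto; [ring|rewrite length_down; lia].
Qed.

Lemma lsum_filter {A} (p : A -> bool) (f : A -> R) L :
  lsum f (filter p L) = lsum (fun a => if p a then f a else 0) L.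
Proof.
  induction L as [|a L IH]; [reflexivity|].
  simpl; rewrite lsum_cons; destruct (p a); rewrite ?lsum_cons, IH; ring.
Qed.

Lemma NoDup_map_filter {A B} (g : A -> B) (p : A -> bool) L :
  NoDup L ->
  (forall a b, In a L -> In b L -> p a = true -> p b = true -> g a = g b -> a = b) ->
  NoDup (map g (filter p L)).
Proof.
  intros HL H; apply NoDup_map_NoDup_ForallPairs; [|apply NoDup_filter; auto].
  intros a b Ha Hb; apply filter_In in Ha, Hb; apply H; tauto.
Qed.

(* The weight [exp t > 1] splits the square of the transport relation
   [f eta = a f eta' + k g], paying [1 / (1 - exp (-t))] on the bond term. *)
Lemma sqr_sum_weighted t a b : 0 < t ->
  (a + b) ^ 2 <= exp t * a ^ 2 + (1 + / (exp t - 1)) * b ^ 2.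
Proof.
  intros Ht; assert (H : 0 < exp t - 1) by (pose proof (exp_ineq1 t); lra).
  set (e := exp t - 1) in *; replace (exp t) with (1 + e) by (unfold e; ring).
  assert (E : (1 + e) * a ^ 2 + (1 + / e) * b ^ 2 - (a + b) ^ 2 = / e * (e * a - b) ^ 2)
    by (field; lra).
  assert (0 <= / e * (e * a - b) ^ 2); [|lra].
  apply Rmult_le_pos; [left; apply Rinv_0_lt_compat; auto|apply pow2_ge_0].
Qed.

Section Coercivity.

Context (d : nat) (lam m : nat -> R).
Context (lam_pos : forall i, (i < d)%nat -> 0 < lam i).
Context (t : R) (t_pos : 0 < t).

(** A pair in such a list is a configuration together with one marked particle, the one that will be
    moved. *)
Let occupied (l : list (config * site)) :=
  forall p, In p l -> fst p (snd p) = true.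

(** The ratio of $\lambda^y$ to $\lambda^{y'}$ with $y'$ the site [move s y]: the factor by which
    [f] changes under the move when the bond term vanishes. *)
Definition amp (s : step) : R := exp (- sgn s (fun i => ln (lam i))).

Definition kap (s : step) : R :=
  if snd s then (1 + lam (fst s) ^ 2) / lam (fst s) ^ 2 else 1 + lam (fst s) ^ 2.

(** [wt] and [cst] are the two coefficients that [sqr_sum_weighted] yields for the relation in
    [hb_transport]. *)
Definition wt (s : step) : R := exp t * amp s ^ 2.

Definition cst (s : step) : R := (1 + / (exp t - 1)) * kap s ^ 2.

Lemma amp_eq s : (fst s < d)%nat ->
  amp s = if snd s then / lam (fst s) else lam (fst s).
Proof.
  intros H; assert (P := lam_pos _ H); unfold amp, sgn; destruct (snd s).
  - rewrite exp_Ropp, exp_ln; auto.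
  - rewrite Ropp_involutive, exp_ln; auto.
Qed.

Lemma kap_ge_1 s : (fst s < d)%nat -> 1 <= kap s.
Proof.
  intros H; assert (P := lam_pos _ H); unfold kap; destruct (snd s).
  - replace ((1 + lam (fst s) ^ 2) / lam (fst s) ^ 2) with (1 + / lam (fst s) ^ 2)
      by (field; lra).
    assert (0 < / lam (fst s) ^ 2); [|lra].
    apply Rinv_0_lt_compat, pow_lt, P.
  - pose proof (pow2_ge_0 (lam (fst s))); lra.
Qed.

Lemma cst_ge_1 s : (fst s < d)%nat -> 1 <= cst s.
Proof.
  intros H; assert (K := kap_ge_1 s H); unfold cst.
  assert (0 < / (exp t - 1))
    by (apply Rinv_0_lt_compat; pose proof (exp_ineq1 t); lra).
  assert (1 <= kap s ^ 2) by nra.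
  nra.
Qed.

Lemma wt_pos s : 0 < wt s.
Proof. apply Rmult_lt_0_compat; [|apply pow_lt]; apply exp_pos. Qed.

Lemma bond_ok_move s y : (fst s < d)%nat -> inD d m y -> inD d m (move s y) ->
  bond_ok d m (fst (bond s y)) (fst s).
Proof.
  destruct s as [j []]; unfold bond, move, bond_ok; simpl; intros Hj Hy Hy'; auto.
  rewrite shift_down; auto; destruct Hy; lia.
Qed.

Lemma hb_blocked f s eta y :
  (fst s < d)%nat -> inD d m y -> inD d m (move s y) ->
  eta y = true -> eta (move s y) = true ->
  hb d lam m f eta (bond s y) = f eta.
Proof.
  intros Hs Hy Hy' O O'; assert (ok := bond_ok_move s y Hs Hy Hy').
  destruct Hy as [Hy _].
  destruct s as [j []]; unfold bond, move in *; simpl in *;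
    destruct (excluded_middle_informative _) as [ok'|n]; try contradiction;
    unfold h_local; rewrite ?shift_down, O, O' by lia; reflexivity.
Qed.

(** The formula for the projection at a bond with exactly one particle, solved for [f eta]; [kap s]
    is the resulting coefficient of the bond term. *)
Lemma hb_transport f s eta y :
  (fst s < d)%nat -> inD d m y -> inD d m (move s y) ->
  eta y = true -> eta (move s y) = false ->
  f eta = amp s * f (swap eta y (move s y)) + kap s * hb d lam m f eta (bond s y).
Proof.
  intros Hs Hy Hy' O O'; assert (ok := bond_ok_move s y Hs Hy Hy').
  rewrite amp_eq by auto; unfold kap; assert (P := lam_pos _ Hs).
  assert (H1 := one_plus_sqr_neq0 (lam (fst s))).
  destruct Hy as [Hy _].
  destruct s as [j []]; unfold bond, move in *; simpl in *;
    destruct (excluded_middle_informative _) as [ok'|n]; try contradiction;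
    unfold h_local; rewrite ?shift_down, O, O' by lia.
  - field; split; auto; lra.
  - rewrite (swap_comm eta (down y j)); field; auto.
Qed.

Let sqsum (f : config -> R) (P : list (config * site)) :=
  lsum (fun p => f (fst p) ^ 2) P.

(** For a fixed step the site is recovered from its bond, so distinct marked configurations use
    distinct terms of the energy. *)
Lemma energy_ge_bonds f s P : fin d m f -> (fst s < d)%nat -> NoDup P ->
  (forall p, In p P -> inD d m (snd p)) ->
  lsum (fun p => hb d lam m f (fst p) (bond s (snd p)) ^ 2) P <= energy d lam m f.
Proof.
  intros Hf Hs HP HD.
  set (phi := fun p : config * site => (fst p, bond s (snd p))).
  change (lsum (fun p => (fun q => hb d lam m f (fst q) (snd q) ^ 2) (phi p)) P
          <= energy d lam m f).
  rewrite <- (lsum_map (fun q => hb d lam m f (fst q) (snd q) ^ 2) phi).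
  apply lsum_le_fsum.
  - intros; apply pow2_ge_0.
  - apply finsupp_sqr, hb_finsupp, Hf.
  - apply NoDup_map_NoDup_ForallPairs; auto.
    intros [e y] [e' y'] H H'; apply HD in H as [L _], H' as [L' _]; simpl in L, L'.
    unfold phi, bond; simpl; destruct s as [j []]; simpl in *; intros [= -> E];
      f_equal; auto.
    rewrite <- (shift_down y j), <- (shift_down y' j), E by lia; auto.
Qed.

(** Marked particles whose next site is occupied are paid for by the energy and leave the list; the
    others move. Since the step and the swap can be undone, the moved pairs stay distinct, so the
    bound can be iterated with one copy of the energy per step. *)
Lemma step_sum f s P : fin d m f -> (fst s < d)%nat -> NoDup P -> occupied P ->
  (forall p, In p P -> inD d m (snd p) /\ inD d m (move s (snd p))) ->
  exists P', NoDup P' /\ occupied P' /\ (length P' <= length P)%nat /\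
    (forall p', In p' P' -> exists p, In p P /\ snd p' = move s (snd p)) /\
    sqsum f P <= cst s * energy d lam m f + wt s * sqsum f P'.
Proof.
  intros Hf Hs HP HO HD.
  set (free := fun p : config * site => negb (fst p (move s (snd p)))).
  set (mv := fun p : config * site =>
               (swap (fst p) (snd p) (move s (snd p)), move s (snd p))).
  exists (map mv (filter free P)); repeat split.
  - apply NoDup_map_filter; auto.
    intros [e y] [e' y'] H H' _ _; unfold mv; simpl; intros [= E1 E2].
    apply HD in H as [[L _] _], H' as [[L' _] _]; simpl in L, L'.
    assert (y = y') as <-
      by (rewrite <- (unmove_move s y), <- (unmove_move s y'), E2 by lia; auto).
    f_equal; rewrite <- (swap_invol e y (move s y)), E1; apply swap_invol.
  - intros p H; apply in_map_iff in H as ([e y] & <- & H).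
    apply filter_In in H as [H _]; apply HO in H; simpl in *.
    rewrite swap_r; auto.
  - rewrite length_map; apply filter_length_le.
  - intros p H; apply in_map_iff in H as (q & <- & H).
    apply filter_In in H as [H _]; exists q; auto.
  - unfold sqsum; rewrite lsum_map, lsum_filter.
    eapply Rle_trans; [|apply Rplus_le_compat_r, Rmult_le_compat_l,
      (energy_ge_bonds f s P)]; auto; [|assert (C := cst_ge_1 s Hs); lra|].
    2: { intros p Hp; apply HD, Hp. }
    set (G := fun p : config * site =>
      if free p then f (fst (mv p)) ^ 2 else 0).
    set (E := fun p : config * site => hb d lam m f (fst p) (bond s (snd p)) ^ 2).
    transitivity (lsum (fun p => cst s * E p + (wt s * G p + 0)) P).
    2: { rewrite lsum_lin, lsum_lin, (lsum_0 (fun _ => 0)) by auto.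
      unfold E, G; lra. }
    apply lsum_le; intros [e y] Hp; assert (O := HO _ Hp).
    apply HD in Hp as [Hy Hy']; cbn [fst snd] in *; unfold E, G, free, mv; cbn [fst snd].
    destruct (e (move s y)) eqn:O'; cbn [negb].
    (* Here the bond term is [f e] itself, and [cst s >= 1] covers its square. *)
    + rewrite (hb_blocked f s e y); auto.
      assert (C := cst_ge_1 s Hs); assert (Q := pow2_ge_0 (f e)); nra.
    + rewrite (hb_transport f s e y); auto.
      assert (Q := sqr_sum_weighted t (amp s * f (swap e y (move s y)))
        (kap s * hb d lam m f e (bond s y)) t_pos).
      unfold cst, wt; lra.
Qed.

(** * Paths, and the composition of the step bounds along them *)

Fixpoint path_ok (l : list step) (y : site) : Prop :=
  match l with
  | [] => True
  | s :: l => inD d m y /\ inD d m (move s y) /\ path_ok l (move s y)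
  end.

Fixpoint path_wt (l : list step) : R :=
  match l with [] => 1 | s :: l => wt s * path_wt l end.

Fixpoint path_cst (l : list step) : R :=
  match l with [] => 0 | s :: l => cst s + wt s * path_cst l end.

Lemma path_wt_pos l : 0 < path_wt l.
Proof.
  induction l as [|s l IH]; simpl; [lra|].
  apply Rmult_lt_0_compat; auto using wt_pos.
Qed.

Lemma path_cst_nonneg l : (forall s, In s l -> (fst s < d)%nat) -> 0 <= path_cst l.
Proof.
  induction l as [|s l IH]; simpl; intros H; [lra|].
  assert (C := cst_ge_1 s (H s (or_introl eq_refl))).
  assert (W := wt_pos s).
  assert (0 <= path_cst l) by auto.
  nra.
Qed.

Lemma path_wt_app l l' : path_wt (l ++ l') = path_wt l * path_wt l'.
Proof. induction l as [|s l IH]; simpl; rewrite ?IH; ring. Qed.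

Lemma path_cst_app l l' :
  path_cst (l ++ l') = path_cst l + path_wt l * path_cst l'.
Proof. induction l as [|s l IH]; simpl; rewrite ?IH; ring. Qed.

Lemma path_sum f l P : fin d m f -> (forall s, In s l -> (fst s < d)%nat) ->
  NoDup P -> occupied P -> (forall p, In p P -> path_ok l (snd p)) ->
  exists P', (length P' <= length P)%nat /\
    sqsum f P <= path_cst l * energy d lam m f + path_wt l * sqsum f P'.
Proof.
  intros Hf; revert P; induction l as [|s l IH]; intros P Hl HP HO Hok.
  - exists P; split; simpl; [auto|lra].
  - destruct (step_sum f s P) as (P1 & N1 & O1 & L1 & M1 & E1); auto with datatypes.
    { intros p Hp; apply Hok in Hp as (? & ? & _); auto. }
    destruct (IH P1) as (P2 & L2 & E2); auto with datatypes.
    { intros p Hp; destruct (M1 p Hp) as (q & Hq & ->).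
      apply Hok in Hq as (_ & _ & ?); auto. }
    exists P2; split; [lia|simpl].
    assert (W := wt_pos s).
    apply (Rmult_le_compat_l (wt s)) in E2; lra.
Qed.

Definition laps (c : list step) (q : nat) : list step := concat (repeat c q).

Lemma path_wt_laps c q : path_wt (laps c q) = path_wt c ^ q.
Proof.
  unfold laps; induction q as [|q IH]; simpl; [reflexivity|].
  rewrite path_wt_app, IH; reflexivity.
Qed.

(** The constants of successive laps are partial sums of a geometric series, so the bound does not
    depend on the number of laps. *)
Lemma path_cst_laps c q : (forall s, In s c -> (fst s < d)%nat) -> path_wt c < 1 ->
  path_cst (laps c q) <= path_cst c / (1 - path_wt c).
Proof.
  intros Hc Hw; assert (P := path_cst_nonneg c Hc); assert (W := path_wt_pos c).
  apply Rmult_le_reg_r with (1 - path_wt c); [lra|].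
  unfold Rdiv; rewrite Rmult_assoc, Rinv_l, Rmult_1_r by lra.
  unfold laps; induction q as [|q IH]; simpl; [lra|].
  rewrite path_cst_app.
  apply (Rmult_le_compat_l (path_wt c)) in IH; lra.
Qed.

(** Mark one particle in each configuration of the support and run [q] laps, with [q] so large that
    the remainder is at most half of the norm and can be absorbed; hence the factor 2. Although [q]
    depends on [f], the constant in front of the energy does not. *)
Lemma coercivity_of_cycle c f : (forall s, In s c -> (fst s < d)%nat) ->
  path_wt c < 1 ->
  (forall q y, inD d m y -> path_ok (laps c q) y) ->
  fin d m f -> f (fun _ => false) = 0 ->
  fsum (fun eta => f eta ^ 2) <=
    2 * (path_cst c / (1 - path_wt c)) * energy d lam m f.
Proof.
  intros Hc Hw Hok Hf Hvac.
  assert (Sf := finsupp_sqr _ (proj1 Hf)).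
  destruct (finsupp_nodup f (proj1 Hf)) as (L & NL & HL).
  set (L' := filter (fun eta => if Req_EM_T (f eta) 0 then false else true) L).
  assert (HP : forall K, (forall eta, In eta K -> f eta <> 0) ->
    exists P, map fst P = K /\ occupied P /\ forall p, In p P -> inD d m (snd p)).
  { induction K as [|eta K IH]; intros HK.
    - exists []; split; [reflexivity|split; intros ? []].
    - destruct IH as (P & EP & OP & DP); [auto with datatypes|].
      assert (He := HK eta (or_introl eq_refl)).
      (* As [f] vanishes on the vacuum, [eta] carries a particle; any one may be marked. *)
      assert (exists x, eta x = true) as [x Hx].
      { apply NNPP; intros N; apply He; rewrite <- Hvac; f_equal.
        extensionality x; apply Bool.not_true_iff_false; intros T; apply N; eauto. }
      exists ((eta, x) :: P); split; [simpl; f_equal; auto|split].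
      + intros p [<-|Hp]; auto.
      + intros p [<-|Hp]; simpl; [apply (proj2 Hf eta He), Hx|apply DP; auto]. }
  destruct (HP L') as (P & EP & OP & DP).
  { intros eta H; apply filter_In in H as [_ H].
    destruct (Req_EM_T (f eta) 0); [discriminate|auto]. }
  assert (NP : NoDup P).
  { apply (NoDup_map_inv fst); rewrite EP; apply NoDup_filter; auto. }
  assert (Ef : fsum (fun eta => f eta ^ 2) = sqsum f P).
  { unfold sqsum; rewrite <- (lsum_map (fun eta => f eta ^ 2) fst), EP.
    apply fsum_lsum; [apply NoDup_filter; auto|].
    intros eta H; assert (f eta <> 0) by (intros E; apply H; rewrite E; ring).
    apply filter_In; split; auto.
    destruct (Req_EM_T (f eta) 0); auto. }
  set (n := fsum (fun eta => f eta ^ 2)) in *.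
  assert (Hn : 0 <= n) by (apply fsum_nonneg; auto; intros; apply pow2_ge_0).
  assert (W := path_wt_pos c).
  (* The remainder will be at most [path_wt c ^ q * INR (length P) * n], so this [q] makes it at
     most [n / 2]; the [+ 1] covers an empty [P]. *)
  destruct (pow_lt_1_zero (path_wt c)) with (y := / (2 * (INR (length P) + 1)))
    as [q Hq].
  { rewrite Rabs_pos_eq; lra. }
  { apply Rinv_0_lt_compat; pose proof (pos_INR (length P)); lra. }
  specialize (Hq q (le_n q)).
  rewrite Rabs_pos_eq in Hq by (apply pow_le; lra).
  destruct (path_sum f (laps c q) P) as (P' & LP' & E); auto.
  { intros s Hs; apply in_concat in Hs as (l & Hl & Hs).
    apply repeat_spec in Hl; subst; auto. }
  assert (HE : 0 <= energy d lam m f).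
  { apply fsum_nonneg; [intros; apply pow2_ge_0|].
    apply finsupp_sqr, hb_finsupp, Hf. }
  (* The final list may repeat a configuration with different marked particles, so each term is
     bounded by [n] separately. *)
  assert (B : sqsum f P' <= INR (length P) * n).
  { transitivity (INR (length P') * n).
    - unfold sqsum; rewrite <- lsum_const; apply lsum_le; intros p _.
      apply (fsum_ge_term (fun eta => f eta ^ 2)); auto; intros; apply pow2_ge_0.
    - apply Rmult_le_compat_r, le_INR; auto. }
  rewrite path_wt_laps, <- Ef in E.
  assert (G := path_cst_laps c q Hc Hw).
  assert (H1 : path_wt c ^ q * sqsum f P' <= n / 2).
  { transitivity (path_wt c ^ q * (INR (length P) * n)).
    - apply Rmult_le_compat_l; auto; apply pow_le; lra.
    - pose proof (pos_INR (length P)) as I.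
      transitivity (/ (2 * (INR (length P) + 1)) * ((INR (length P) + 1) * n)).
      + apply Rmult_le_compat; [apply pow_le; lra|nra|lra|nra].
      + right; field; lra. }
  apply (Rmult_le_compat_r (energy d lam m f)) in G; lra.
Qed.

End Coercivity.

(** * Directions along which the weights grow inside the half-space *)

Definition target (l : list step) (y : site) : site :=
  fold_left (fun z s => move s z) l y.

Lemma path_ok_app d m l l' y :
  path_ok d m l y -> path_ok d m l' (target l y) -> path_ok d m (l ++ l') y.
Proof.
  revert y; induction l as [|s l IH]; simpl; intros y; [auto|].
  intros (? & ? & ?) ?; auto.
Qed.

(** The pairing with [m] is affine along a straight segment, so a segment with both ends in the
    half-space stays inside. *)
Lemma path_ok_repeat d m s n y : (fst s < d)%nat -> inD d m y ->
  0 <= dotZ d m y + INR n * sgn s m ->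
  path_ok d m (repeat s n) y /\ inD d m (target (repeat s n) y) /\
  dotZ d m (target (repeat s n) y) = dotZ d m y + INR n * sgn s m.
Proof.
  intros Hs; revert y; induction n as [|n IH]; intros y Hy Hn.
  - simpl in *; repeat split; try apply Hy; ring.
  - rewrite S_INR in *; destruct Hy as [Ly Dy].
    assert (I := pos_INR n).
    assert (Hm : 0 <= dotZ d m y + sgn s m).
    { destruct (Rle_lt_dec 0 (sgn s m)); [lra|nra]. }
    assert (Hy' : inD d m (move s y)).
    { split; [rewrite length_move; lia|rewrite dotZ_move; auto]. }
    destruct (IH (move s y) Hy') as (P & T & E).
    { rewrite dotZ_move; auto; lra. }
    rewrite dotZ_move in E by auto; simpl.
    repeat split; auto; try apply T; try apply Hy'; rewrite E; ring.
Qed.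

(** The leg that does not decrease [m . y] comes first; the second leg then ends no lower than the
    lap began, so every lap starts in [D]. *)
Lemma path_ok_laps d m s1 s2 n1 n2 q y :
  (fst s1 < d)%nat -> (fst s2 < d)%nat -> 0 <= sgn s1 m ->
  0 <= INR n1 * sgn s1 m + INR n2 * sgn s2 m -> inD d m y ->
  path_ok d m (laps (repeat s1 n1 ++ repeat s2 n2) q) y.
Proof.
  intros H1 H2 C1 C; unfold laps; revert y; induction q as [|q IH]; intros y Hy;
    [exact I|].
  simpl; rewrite <- app_assoc.
  assert (Dy := proj2 Hy).
  assert (0 <= INR n1 * sgn s1 m) by (apply Rmult_le_pos; auto using pos_INR).
  destruct (path_ok_repeat d m s1 n1 y) as (P1 & T1 & E1); auto; [lra|].
  destruct (path_ok_repeat d m s2 n2 (target (repeat s1 n1) y)) as (P2 & T2 & _);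
    auto; [lra|].
  apply path_ok_app; auto; apply path_ok_app; auto.
Qed.

Lemma exp_pow x n : exp x ^ n = exp (INR n * x).
Proof.
  induction n as [|n IH]; [simpl; rewrite Rmult_0_l, exp_0; auto|].
  rewrite S_INR; simpl; rewrite IH, <- exp_plus; f_equal; ring.
Qed.

Lemma path_wt_repeat lam t s n :
  path_wt lam t (repeat s n) =
  exp (INR n * (t - 2 * sgn s (fun i => ln (lam i)))).
Proof.
  induction n as [|n IH]; [simpl; rewrite Rmult_0_l, exp_0; auto|].
  rewrite S_INR; simpl; rewrite IH; unfold wt, amp.
  rewrite (exp_pow _ 2), <- !exp_plus; f_equal; simpl; ring.
Qed.

Lemma coercivity_of_direction d lam m s1 s2 n1 n2 :
  (forall i, (i < d)%nat -> 0 < lam i) ->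
  (fst s1 < d)%nat -> (fst s2 < d)%nat ->
  0 <= INR n1 * sgn s1 m + INR n2 * sgn s2 m ->
  0 < INR n1 * sgn s1 (fun i => ln (lam i)) + INR n2 * sgn s2 (fun i => ln (lam i)) ->
  exists delta, 0 < delta /\ forall f, fin d m f -> f (fun _ => false) = 0 ->
    delta * fsum (fun eta => f eta ^ 2) <= energy d lam m f.
Proof.
  intros Hlam; revert s1 s2 n1 n2.
  (* The claim is first proved for legs ordered so that the first one does not point out of [D]. *)
  assert (W : forall s1 s2 n1 n2, (fst s1 < d)%nat -> (fst s2 < d)%nat ->
    0 <= sgn s1 m -> 0 <= INR n1 * sgn s1 m + INR n2 * sgn s2 m ->
    0 < INR n1 * sgn s1 (fun i => ln (lam i)) + INR n2 * sgn s2 (fun i => ln (lam i)) ->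
    exists delta, 0 < delta /\ forall f, fin d m f -> f (fun _ => false) = 0 ->
      delta * fsum (fun eta => f eta ^ 2) <= energy d lam m f).
  { intros s1 s2 n1 n2 H1 H2 C1 C V.
    set (v := fun i => ln (lam i)) in *.
    set (VV := INR n1 * sgn s1 v + INR n2 * sgn s2 v) in *.
    assert (Hn : 0 < INR n1 + INR n2).
    { rewrite <- plus_INR; apply lt_0_INR.
      destruct n1, n2; try lia; unfold VV in V; simpl in V; lra. }
    (* The mean gain of $\log\lambda^x$ per step. The cycle has weight
       [exp ((n1 + n2) * t - 2 * VV)], which becomes [exp (- VV)]. *)
    set (t := VV / (INR n1 + INR n2)).
    assert (Ht : 0 < t) by (apply Rdiv_lt_0_compat; auto).
    set (c := repeat s1 n1 ++ repeat s2 n2).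
    assert (Hc : forall s, In s c -> (fst s < d)%nat).
    { intros s Hs; apply in_app_or in Hs as [Hs|Hs];
        apply repeat_spec in Hs; subst; auto. }
    assert (Hw : path_wt lam t c < 1).
    { unfold c; rewrite path_wt_app, !path_wt_repeat, <- exp_plus, <- exp_0.
      apply exp_increasing; fold v.
      replace (_ + _) with (- VV) by (unfold t, VV; field; lra); lra. }
    assert (A0 := path_cst_nonneg d lam Hlam t Ht c Hc).
    set (A := path_cst lam t c / (1 - path_wt lam t c)).
    assert (HA : 0 <= A).
    { apply Rmult_le_pos; auto; left; apply Rinv_0_lt_compat; lra. }
    exists (/ (2 * A + 1)); split; [apply Rinv_0_lt_compat; lra|].
    intros f Hf Hvac.
    assert (E := coercivity_of_cycle d lam m Hlam t Ht c f Hc Hw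
      (fun q y => path_ok_laps d m s1 s2 n1 n2 q y H1 H2 C1 C) Hf Hvac).
    fold A in E.
    assert (HE : 0 <= energy d lam m f).
    { apply fsum_nonneg; [intros; apply pow2_ge_0|].
      apply finsupp_sqr, hb_finsupp, Hf. }
    apply Rmult_le_reg_l with (2 * A + 1); [lra|].
    rewrite <- Rmult_assoc, Rinv_r by lra; lra. }
  intros s1 s2 n1 n2 H1 H2 C V.
  destruct (Rle_lt_dec 0 (sgn s1 m)) as [L|L]; [eauto|].
  destruct (Rle_lt_dec 0 (sgn s2 m)) as [L'|L'].
  - apply (W s2 s1 n2 n1); auto; lra.
  (* Two legs pointing out of [D] can have nonnegative total only if both are empty, contradicting
     the growth. *)
  - assert (I := pos_INR n1); assert (I' := pos_INR n2).
    assert (Z : INR n1 = 0) by nra; assert (Z' : INR n2 = 0) by nra.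
    rewrite Z, Z' in V; lra.
Qed.

Lemma signed_steps (a : Z) (j : nat) : exists s n, fst s = j /\
  forall v, INR n * sgn s v = IZR a * v j.
Proof.
  exists (j, Z.leb 0 a), (Z.abs_nat a); split; auto; intros v.
  rewrite INR_IZR_INZ, Nat2Z.inj_abs_nat; unfold sgn; simpl.
  destruct (Z.leb_spec 0 a).
  - rewrite Z.abs_eq by lia; ring.
  - rewrite Z.abs_neq, opp_IZR by lia; ring.
Qed.

(** A real combination pairing to 1 with both vectors is scaled up and rounded; for a large scale
    the rounding error cannot change the signs. *)
Lemma integer_direction (a1 a2 b1 b2 : R) : a1 * b2 - a2 * b1 <> 0 ->
  exists p q : Z, 0 < IZR p * a1 + IZR q * a2 /\ 0 < IZR p * b1 + IZR q * b2.
Proof.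
  intros D.
  (* Cramer's rule for the system with right-hand side [(1, 1)]. *)
  set (u := (b2 - a2) / (a1 * b2 - a2 * b1)).
  set (w := (a1 - b1) / (a1 * b2 - a2 * b1)).
  assert (Ea : u * a1 + w * a2 = 1) by (unfold u, w; field; auto).
  assert (Eb : u * b1 + w * b2 = 1) by (unfold u, w; field; auto).
  (* The scale exceeds by 1 the largest possible error, since rounding up moves each coefficient by
     at most 1. *)
  set (t := 1 + Rabs a1 + Rabs a2 + Rabs b1 + Rabs b2).
  assert (R1 : forall x c, 0 < x <= 1 -> - Rabs c <= x * c).
  { intros x c Hx; assert (P := Rabs_pos c); destruct (Rcase_abs c).
    - rewrite Rabs_left by auto; nra.
    - rewrite Rabs_right by auto; nra. }
  assert (P1 := Rabs_pos a1); assert (P2 := Rabs_pos a2).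
  assert (P3 := Rabs_pos b1); assert (P4 := Rabs_pos b2).
  destruct (archimed (t * u)) as [U1 U2]; destruct (archimed (t * w)) as [W1 W2].
  exists (up (t * u)), (up (t * w)).
  set (x := IZR (up (t * u)) - t * u) in *; set (z := IZR (up (t * w)) - t * w) in *.
  replace (IZR (up (t * u))) with (x + t * u) by (unfold x; ring).
  replace (IZR (up (t * w))) with (z + t * w) by (unfold z; ring).
  assert (Hx : 0 < x <= 1) by (unfold x in *; lra).
  assert (Hz : 0 < z <= 1) by (unfold z in *; lra).
  split.
  - replace (_ + _) with (x * a1 + z * a2 + t * (u * a1 + w * a2)) by ring.
    assert (X := R1 x a1 Hx); assert (Z := R1 z a2 Hz); rewrite Ea; unfold t; lra.
  - replace (_ + _) with (x * b1 + z * b2 + t * (u * b1 + w * b2)) by ring.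
    assert (X := R1 x b1 Hx); assert (Z := R1 z b2 Hz); rewrite Eb; unfold t; lra.
Qed.

Lemma normR_scal d m v c : 0 <= c ->
  (forall i, (i < d)%nat -> v i = - c * m i) -> normR d v = c * normR d m.
Proof.
  intros Hc H; unfold normR.
  change (sqrt (lsum (fun i => v i ^ 2) (seq 0 d)) =
          c * sqrt (lsum (fun i => m i ^ 2) (seq 0 d))).
  rewrite <- (sqrt_pow2 c Hc) at 1; rewrite <- sqrt_mult_alt by apply pow2_ge_0.
  f_equal; transitivity (lsum (fun i => c ^ 2 * m i ^ 2 + 0) (seq 0 d)).
  - apply lsum_ext; intros i Hi; apply in_seq in Hi; rewrite H by lia; ring.
  - rewrite lsum_lin, (lsum_0 (fun _ => 0)) by auto; ring.
Qed.

(* Unless [v] is a nonpositive multiple of [m], two coordinates already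
   contain an integer vector [U] with [m . U >= 0] and [v . U > 0]. *)
Lemma growth_direction d m v : normR d m = 1 ->
  ~ (forall i, (i < d)%nat -> v i = - normR d v * m i) ->
  exists i j p q, (i < d)%nat /\ (j < d)%nat /\
    0 <= IZR p * m i + IZR q * m j /\ 0 < IZR p * v i + IZR q * v j.
Proof.
  intros Hm H.
  (* As [m] is a unit vector, the only possible nonnegative factor is the norm of [v], so all of
     them are excluded. *)
  assert (Hv : forall c, 0 <= c -> ~ (forall i, (i < d)%nat -> v i = - c * m i)).
  { intros c Hc E; apply H; rewrite (normR_scal d m v c Hc E), Hm, Rmult_1_r; auto. }
  destruct (classic (exists j, (j < d)%nat /\ v j <> 0 /\ 0 <= m j * v j))
    as [(j & Hj & Vj & Mj)|N].
  (* A single axis suffices here, oriented by the sign of [v j]. *)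
  - destruct (Rlt_le_dec 0 (v j)).
    + exists j, j, 1%Z, 0%Z; repeat split; auto; nra.
    + exists j, j, (-1)%Z, 0%Z; repeat split; auto; nra.
  - assert (N' : forall j, (j < d)%nat -> v j <> 0 -> m j * v j < 0).
    { intros j Hj Vj; apply Rnot_le_lt; intros L; apply N; eauto. }
    destruct (classic (exists i, (i < d)%nat /\ v i <> 0)) as [(i & Hi & Vi)|Z].
    2: { exfalso; apply (Hv 0 (Rle_refl 0)); intros i Hi.
         rewrite Ropp_0, Rmult_0_l; apply NNPP; eauto. }
    assert (Mi := N' i Hi Vi).
    assert (m i <> 0) by nra.
    assert (Hc : 0 <= - (v i / m i)).
    { replace (- (v i / m i)) with (- (m i * v i) * / (m i ^ 2)) by (field; auto).
      apply Rmult_le_pos; [lra|left; apply Rinv_0_lt_compat; nra]. }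
    (* Coordinate [i] determines the factor; a coordinate where it fails gives a nonzero two-by-two
       minor of [m] and [v]. *)
    assert (exists j, (j < d)%nat /\ v j <> - - (v i / m i) * m j) as (j & Hj & Vj).
    { apply NNPP; intros E; apply (Hv _ Hc); intros j Hj; apply NNPP; eauto. }
    destruct (integer_direction (m i) (m j) (v i) (v j)) as (p & q & P & Q).
    { intros E; apply Vj; apply Rmult_eq_reg_l with (m i); auto.
      replace (m i * (- - (v i / m i) * m j)) with (m j * v i) by (field; auto); lra. }
    exists i, j, p, q; repeat split; auto; lra.
Qed.

Lemma coercivity d lam m :
  (forall i, (i < d)%nat -> 0 < lam i) -> normR d m = 1 ->
  ~ (forall i, (i < d)%nat ->
       ln (lam i) = - normR d (fun k => ln (lam k)) * m i) ->
  exists delta, 0 < delta /\ forall f, fin d m f -> f (fun _ => false) = 0 ->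
    delta * fsum (fun eta => f eta ^ 2) <= energy d lam m f.
Proof.
  intros Hlam Hm H.
  destruct (growth_direction d m (fun k => ln (lam k)) Hm H)
    as (i & j & p & q & Hi & Hj & P & Q).
  destruct (signed_steps p i) as (s1 & n1 & E1 & S1).
  destruct (signed_steps q j) as (s2 & n2 & E2 & S2).
  apply (coercivity_of_direction d lam m s1 s2 n1 n2); auto.
  - congruence.
  - congruence.
  - rewrite S1, S2; auto.
  - rewrite S1, S2; auto.
Qed.

(** * From coercivity to the spectral gap *)

Lemma HDr_vacuum d lam m f : HDr d lam m f (fun _ => false) = 0.
Proof.
  rewrite HDr_fsum, <- (@fsum_0 (site * nat)); f_equal; extensionality b.
  destruct b as [x j]; unfold hb; destruct (excluded_middle_informative _); reflexivity.
Qed.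

Definition vacuum_part (f : config -> R) : config -> R := fun eta =>
  if excluded_middle_informative (eta = fun _ => false) then f eta else 0.

Lemma hb_vacuum_part d lam m f eta b : hb d lam m (vacuum_part f) eta b = 0.
Proof.
  apply NNPP; intros H; destruct b as [x j].
  apply hb_neq0 in H as (_ & Ho & Hv); unfold vacuum_part in Hv.
  assert (N : eta <> fun _ => false) by (intros ->; destruct Ho; discriminate).
  destruct (excluded_middle_informative (eta = _)) as [|_]; [contradiction|].
  destruct (excluded_middle_informative (_ = _)) as [E|_]; [|lra].
  apply N; rewrite <- (swap_invol eta x (shift x j)), E.
  extensionality z; unfold swap.
  destruct (list_eq_dec Z.eq_dec z x), (list_eq_dec Z.eq_dec z (shift x j)); auto.
Qed.

Lemma fin_sector d m f : fin d m f -> exists N, sector N f.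
Proof.
  intros [[L HL] V].
  assert (exists N, forall eta, In eta L -> f eta <> 0 -> count_le N eta) as [N HN].
  { clear HL; induction L as [|e L [N IH]]; [exists 0%nat; intros ? []|].
    destruct (Req_EM_T (f e) 0) as [E|E].
    - exists N; intros eta [<-|Hin] Hf; [contradiction|auto].
    - destruct (V e E) as [[X HX] _]; exists (N + length X)%nat.
      intros eta [<-|Hin] Hf; [exists X; split; auto; lia|].
      destruct (IH eta Hin Hf) as (Y & LY & HY); exists Y; split; auto; lia. }
  exists N; intros eta H; auto.
Qed.

Section Gap.

Context (d : nat) (lam m : nat -> R) (delta mu : R).
Context (coercive : forall f, fin d m f -> f (fun _ => false) = 0 ->
  delta * fsum (fun eta => f eta ^ 2) <= energy d lam m f).
Context (mu_range : 0 < mu < delta).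

Let H := HDr d lam m.
Let n (f : config -> R) := fsum (fun eta => f eta ^ 2).

Lemma fin_finsupp_sqr f : fin d m f -> finsupp (fun eta => f eta ^ 2).
Proof. intros F; apply finsupp_sqr, F. Qed.

Lemma fin_finsupp_mulH f : fin d m f -> finsupp (fun eta => f eta * H f eta).
Proof. intros F; apply finsupp_mul, fin_HDr, F. Qed.

Lemma fin_shifted f : fin d m f -> fin d m (fun eta => H f eta - mu * f eta).
Proof.
  intros F; replace (fun eta => H f eta - mu * f eta)
    with (fun eta => - mu * f eta + H f eta) by (extensionality eta; ring).
  apply fin_lin; [|apply fin_HDr]; auto.
Qed.

(** On the vacuum [H - mu] acts as [- mu]. On the complement [g], with [s = delta - mu], expanding
    $\|(H-\mu)g-sg\|^2\geq 0$ and using coercivity gives $\|(H-\mu)g\|^2\geq s^2\|g\|^2$. *)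
Lemma shifted_bounded_below f : fin d m f ->
  Rmin (mu ^ 2) ((delta - mu) ^ 2) * n f <= n (fun eta => H f eta - mu * f eta).
Proof.
  intros F; set (c := Rmin _ _); set (s := delta - mu).
  assert (Cm : c <= mu ^ 2) by apply Rmin_l.
  assert (Cs : c <= s ^ 2) by apply Rmin_r.
  set (g := fun eta => -1 * vacuum_part f eta + f eta).
  assert (Fv : fin d m (vacuum_part f)).
  { destruct F as [S V]; split; unfold vacuum_part.
    - apply (finsupp_incl f); auto; intros eta.
      destruct (excluded_middle_informative _); auto; lra.
    - intros eta; destruct (excluded_middle_informative _); auto; lra. }
  assert (Fg : fin d m g) by (apply fin_lin; auto).
  assert (Hg : H g = H f).
  { extensionality eta; unfold H, g; rewrite HDr_lin by auto.
    rewrite HDr_fsum at 1; replace (hb d lam m (vacuum_part f) eta)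
      with (fun _ : site * nat => 0)
      by (extensionality b; symmetry; apply hb_vacuum_part).
    rewrite fsum_0; ring. }
  assert (g0 : g (fun _ => false) = 0).
  { unfold g, vacuum_part; destruct (excluded_middle_informative _); [ring|].
    congruence. }
  assert (Q := coercive g Fg g0); fold (n g) in Q.
  assert (Hn : 0 <= n g)
    by (apply fsum_nonneg; [intros; apply pow2_ge_0|apply fin_finsupp_sqr; auto]).
  (* One pointwise lower bound for both cases: at the vacuum [g] is 0 and only [c * f eta ^ 2]
     remains; elsewhere [g] equals [f] and the terms with [c] cancel. *)
  transitivity (fsum (fun eta => c * f eta ^ 2 + (- (c + s ^ 2 + 2 * s * mu) * g eta ^ 2
    + (2 * s * (g eta * H g eta) + 0)))).
  - rewrite fsum_lin3 by auto using fin_finsupp_sqr, fin_finsupp_mulH.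
    unfold H; rewrite quadratic_form_energy by auto; fold (n f) (n g).
    assert (0 < s) by (unfold s; lra).
    apply (Rmult_le_compat_l (2 * s)) in Q; [|lra].
    assert (0 <= (s ^ 2 - c) * n g) by (apply Rmult_le_pos; lra).
    replace delta with (s + mu) in Q by (unfold s; ring).
    lra.
  - apply fsum_le; auto using finsupp_lin, finsupp_0, fin_finsupp_sqr, fin_finsupp_mulH, fin_shifted.
    intros eta; rewrite Hg.
    destruct (classic (eta = fun _ => false)) as [->|Ne].
    + rewrite g0; unfold H; rewrite HDr_vacuum.
      assert (X := Rmult_le_compat_r _ _ _ (pow2_ge_0 (f (fun _ => false))) Cm); lra.
    + replace (g eta) with (f eta).
      2: { unfold g, vacuum_part; destruct (excluded_middle_informative _);
             [contradiction|ring]. }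
      assert (X := pow2_ge_0 (H f eta - mu * f eta - s * f eta)); lra.
Qed.

(* A Richardson step on the equation [(H - mu) psi = r]. *)
Lemma richardson_contraction N : exists t theta, 0 <= theta < 1 /\
  forall r, fin d m r -> sector N r -> r (fun _ => false) = 0 ->
    n (fun eta => - t * (H r eta - mu * r eta) + r eta) <= theta * n r.
Proof.
  set (K := INR (2 * d * N)); assert (HK : 0 <= K) by apply pos_INR.
  set (s := delta - mu); assert (Hs : 0 < s) by (unfold s; lra).
  (* A common denominator large enough that the step size [t = s / D] satisfies the smallness
     conditions [T1] to [T4]. *)
  set (D := (K + 1) * (1 + delta) ^ 2).
  assert (HD : 0 < D) by (unfold D; nra).
  set (t := s / D).
  assert (Ht : 0 < t) by (apply Rdiv_lt_0_compat; auto).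
  assert (tD : t * D = s) by (unfold t; field; lra).
  assert (D1 : K * delta <= D) by (unfold D; nra).
  assert (D2 : K * (1 + delta) <= D) by (unfold D; nra).
  assert (D3 : (1 + delta) ^ 2 <= D) by (unfold D; nra).
  assert (Sd : s < 1 + delta) by (unfold s; lra).
  apply (Rmult_le_compat_l t) in D1; [|lra].
  apply (Rmult_le_compat_l t) in D2; [|lra].
  apply (Rmult_le_compat_l t) in D3; [|lra].
  assert (T1 : t * (K * delta) <= s) by lra.
  assert (T2 : t * K < 1) by (apply Rmult_lt_reg_r with (1 + delta); lra).
  assert (T3 : t * (1 + delta) < 1) by (apply Rmult_lt_reg_r with (1 + delta); lra).
  assert (T4 : t * s < 1) by nra.
  exists t, (1 - t * s); split; [nra|].
  intros r Fr Sr r0.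
  assert (Q := coercive r Fr r0); fold (n r) in Q.
  assert (B := HDr_norm_le_energy d lam m N r Fr Sr); fold H K in B.
  assert (Hn : 0 <= n r)
    by (apply fsum_nonneg; [intros; apply pow2_ge_0|apply fin_finsupp_sqr; auto]).
  set (e := energy d lam m r) in *.
  transitivity ((1 + t * mu) ^ 2 * n r +
    (- (2 * t * (1 + t * mu)) * e + t ^ 2 * fsum (fun eta => H r eta ^ 2))).
  - right; unfold e; rewrite <- quadratic_form_energy by auto; fold H.
    unfold n; rewrite <- fsum_lin3;
      auto using fin_finsupp_sqr, fin_finsupp_mulH.
    + f_equal; extensionality eta; ring.
    + apply fin_finsupp_sqr, fin_HDr; auto.
  (* The sector bound replaces $\|Hr\|^2$ by [K * e]. The total coefficient of [e] is then
     nonpositive, so coercivity can be used as a lower bound on [e]. *)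
  - apply (Rmult_le_compat_l (t ^ 2)) in B; [|nra].
    assert (C : 0 <= 2 * t * (1 + t * mu) - t ^ 2 * K).
    { replace (2 * t * (1 + t * mu) - t ^ 2 * K)
        with (t * ((1 - t * K) + 1 + 2 * (t * mu))) by ring.
      assert (0 < t * mu) by nra; apply Rmult_le_pos; lra. }
    apply (Rmult_le_compat_l _ _ _ C) in Q.
    assert (X : (1 + t * mu) ^ 2 - (2 * t * (1 + t * mu) - t ^ 2 * K) * delta <= 1 - t * s).
    { replace ((1 + t * mu) ^ 2 - (2 * t * (1 + t * mu) - t ^ 2 * K) * delta)
        with (1 - 2 * (t * s) + t * (t * (K * delta)) + t ^ 2 * (mu * (mu - 2 * delta)))
        by (unfold s; ring).
      assert (t * (t * (K * delta)) <= t * s) by nra.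
      assert (t ^ 2 * (mu * (mu - 2 * delta)) <= 0); [|lra].
      assert (0 < t ^ 2) by nra.
      assert (mu * (mu - 2 * delta) < 0) by nra.
      nra. }
    apply (Rmult_le_compat_r (n r)) in X; auto; lra.
Qed.

Lemma shifted_lin c f g eta : fin d m f -> fin d m g ->
  H (fun e => c * f e + g e) eta - mu * (c * f eta + g eta) =
  c * (H f eta - mu * f eta) + (H g eta - mu * g eta).
Proof. intros; unfold H; rewrite HDr_lin by auto; ring. Qed.

(** The new residual stays in sector [N] and off the vacuum, so the same [theta] serves at every
    step. *)
Lemma richardson_iteration N : exists theta, 0 <= theta < 1 /\
  forall k g, fin d m g -> sector N g -> g (fun _ => false) = 0 ->
  exists f, fin d m f /\
    n (fun eta => g eta - (H f eta - mu * f eta)) <= theta ^ k * n g.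
Proof.
  destruct (richardson_contraction N) as (t & theta & Hth & C).
  exists theta; split; auto.
  induction k as [|k IH]; intros g Fg Sg g0.
  - exists (fun _ => 0); split; [split; [apply finsupp_0|intros; lra]|].
    right; rewrite pow_O, Rmult_1_l; f_equal; extensionality eta.
    unfold H; rewrite HDr_fsum.
    replace (hb d lam m (fun _ => 0) eta) with (fun _ : site * nat => 0);
      [rewrite fsum_0; ring|].
    extensionality b; symmetry; apply NNPP; intros X; destruct b as [x j].
    apply hb_neq0 in X as (_ & _ & [X|X]); lra.
  - set (g' := fun eta => - t * (H g eta - mu * g eta) + g eta).
    assert (Fg' : fin d m g') by (apply fin_lin; auto; apply fin_shifted; auto).
    destruct (IH g') as (f & Ff & E); auto.
    { intros eta X; unfold g' in X.
      destruct (Req_EM_T (g eta) 0) as [E|E]; auto.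
      apply (HDr_sector d lam m N g); auto.
      intros E'; apply X; unfold H; rewrite E, E'; ring. }
    { unfold g', H; rewrite HDr_vacuum, g0; ring. }
    (* The residual of [t * g + f] for [g] equals that of [f] for [g']. *)
    exists (fun eta => t * g eta + f eta); split; [apply fin_lin; auto|].
    assert (C' := C g Fg Sg g0); fold g' in C'.
    transitivity (theta ^ k * n g').
    + replace (fun eta => g eta - _)
        with (fun eta => g' eta - (H f eta - mu * f eta)); auto.
      extensionality eta; rewrite shifted_lin by auto; unfold g'; ring.
    + apply (Rmult_le_compat_l (theta ^ k)) in C'; [|apply pow_le; lra].
      simpl; lra.
Qed.

(* Starting at [- g / mu] leaves the residual [H g / mu], which has no
   vacuum component. *)
Lemma shifted_dense_range g eps : fin d m g -> 0 < eps ->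
  exists f, fin d m f /\ n (fun eta => (H f eta - mu * f eta) - g eta) < eps.
Proof.
  intros Fg Heps.
  set (r := fun eta => / mu * H g eta + 0).
  assert (F0 : fin d m (fun _ => 0)) by (split; [apply finsupp_0|intros; lra]).
  assert (Fr : fin d m r) by (apply fin_lin; auto; apply fin_HDr; auto).
  destruct (fin_sector d m r Fr) as [N HN].
  destruct (richardson_iteration N) as (theta & Hth & It).
  assert (Hn : 0 <= n r)
    by (apply fsum_nonneg; [intros; apply pow2_ge_0|apply fin_finsupp_sqr; auto]).
  destruct (pow_lt_1_zero theta) with (y := eps / (n r + 1)) as [k Hk].
  { rewrite Rabs_pos_eq; lra. }
  { apply Rdiv_lt_0_compat; lra. }
  specialize (Hk k (le_n k)); rewrite Rabs_pos_eq in Hk by (apply pow_le; lra).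
  destruct (It k r Fr HN) as (f & Ff & E).
  { unfold r, H; rewrite HDr_vacuum; ring. }
  exists (fun eta => - / mu * g eta + f eta); split; [apply fin_lin; auto|].
  replace (fun eta => _ - g eta) with (fun eta => - (r eta - (H f eta - mu * f eta))).
  2: { extensionality eta; rewrite shifted_lin by auto; unfold r; field; lra. }
  unfold n in *; replace (fun eta => (- (r eta - (H f eta - mu * f eta))) ^ 2)
    with (fun eta => (r eta - (H f eta - mu * f eta)) ^ 2)
    by (extensionality eta; ring).
  eapply Rle_lt_trans; [exact E|].
  set (nr := fsum (fun eta => r eta ^ 2)) in *.
  assert (X : eps / (nr + 1) * (nr + 1) = eps) by (field; lra).
  assert (0 <= theta ^ k) by (apply pow_le; lra).
  nra.
Qed.

(** * Complex vectors through their real and imaginary parts *)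

Lemma fin_vec_fst psi : fin_vec d m psi -> fin d m (fun e => fst (psi e)).
Proof.
  intros [[L HL] V]; split; [exists L|]; intros eta X; [apply HL|apply V];
    intros E; apply X; rewrite E; reflexivity.
Qed.

Lemma fin_vec_snd psi : fin_vec d m psi -> fin d m (fun e => snd (psi e)).
Proof.
  intros [[L HL] V]; split; [exists L|]; intros eta X; [apply HL|apply V];
    intros E; apply X; rewrite E; reflexivity.
Qed.

Lemma fin_vec_pair f g : fin d m f -> fin d m g -> fin_vec d m (fun e => (f e, g e)).
Proof.
  intros [[L HL] V] [[M HM] V'].
  assert (X : forall eta, (f eta, g eta) <> (0, 0) -> f eta <> 0 \/ g eta <> 0).
  { intros eta X; apply NNPP; intros N; apply X; f_equal; apply NNPP; tauto. }
  split; [exists (L ++ M); intros eta E; apply in_or_app|intros eta E];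
    apply X in E as [E|E]; auto.
Qed.

Lemma norm2_split psi : finsupp (fun e => fst (psi e)) -> finsupp (fun e => snd (psi e)) ->
  norm2 psi = n (fun e => fst (psi e)) + n (fun e => snd (psi e)).
Proof.
  intros; unfold norm2, n.
  rewrite <- (Rmult_1_l (fsum (fun eta => fst (psi eta) ^ 2))), <- fsum_lin
    by (apply finsupp_sqr; auto).
  f_equal; extensionality eta; ring.
Qed.

Lemma mu_in_resolvent : in_resolvent d lam m mu.
Proof.
  split.
  - exists (Rmin (mu ^ 2) ((delta - mu) ^ 2)); split.
    { apply Rmin_glb_lt; apply pow_lt; lra. }
    intros psi Hpsi.
    assert (F1 := fin_vec_fst psi Hpsi); assert (F2 := fin_vec_snd psi Hpsi).
    assert (G1 := fin_shifted _ F1); assert (G2 := fin_shifted _ F2).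
    rewrite !norm2_split; try apply F1; try apply F2; try apply G1; try apply G2.
    assert (X1 := shifted_bounded_below _ F1); assert (X2 := shifted_bounded_below _ F2).
    rewrite Rmult_plus_distr_l; exact (Rplus_le_compat _ _ _ _ X1 X2).
  - intros phi Hphi eps Heps.
    assert (F1 := fin_vec_fst phi Hphi); assert (F2 := fin_vec_snd phi Hphi).
    destruct (shifted_dense_range _ (eps / 2) F1) as (f & Ff & E1); [lra|].
    destruct (shifted_dense_range _ (eps / 2) F2) as (g & Fg & E2); [lra|].
    exists (fun e => (f e, g e)); split; [apply fin_vec_pair; auto|].
    assert (D : forall u v, fin d m u -> fin d m v ->
      finsupp (fun e => (H u e - mu * u e) - v e)).
    { intros u v Fu Fv; apply fin_shifted in Fu.
      replace (fun e => (H u e - mu * u e) - v e)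
        with (fun e => -1 * v e + (H u e - mu * u e)) by (extensionality e; ring).
      apply (fin_lin d m v _ (-1) Fv Fu). }
    assert (D1 := D f _ Ff F1); assert (D2 := D g _ Fg F2).
    rewrite norm2_split; [|exact D1|exact D2].
    eapply Rlt_le_trans; [exact (Rplus_lt_compat _ _ _ _ E1 E2)|lra].
Qed.

End Gap.

Theorem theorem2p2 (d : nat) (lam m : nat -> R) :
  (2 <= d)%nat ->
  (forall i, (i < d)%nat -> 0 < lam i) ->
  normR d m = 1 ->
  ~ (forall i, (i < d)%nat ->
       ln (lam i) = - normR d (fun k => ln (lam k)) * m i) ->
  spectral_gap_pos d lam m.
Proof.
  intros _ Hlam Hm Hne.
  destruct (coercivity d lam m Hlam Hm Hne) as (delta & Hdelta & Hco).
  exists delta; split; auto; intros mu Hmu Hspec; apply Hspec.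
  apply (mu_in_resolvent d lam m delta mu); auto.
Qed.
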